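(* Let $(\Omega,\mathscr F,\mu)$ be a complete measure space with a $\sigma$-finite measure $\mu$, and let $(X,\|\cdot\|)$ be a Banach ideal space on $(\Omega,\mathscr F,\mu)$. Then $X$ has the Kreps-Yan property: for every norm-closed convex cone $C\subset X$ satisfying $$C\cap X_+=\{0\},\qquad -X_+\subset C,$$ there exists a strictly positive element $g\in X'$ such that $\langle x,g\rangle\le 0$ for all $x\in C$.
   Context: All vector spaces are real. Let $(\Omega,\mathscr F)$ be a measurable space which is complete with respect to a countably additive measure $\mu:\mathscr F\to[0,\infty]$. $L^0(\mu)=L^0(\Omega,\mathscr F,\mu)$ is the vector lattice of classes of $\mu$-equivalent, a.e. finite $\mathscr F$-measurable real functions, ordered by the cone of (a.e.) non-negative elements. A solid subspace (ideal) $X$ of $L^0(\mu)$ is a linear subspace such that $x\in X$, $y\in L^0(\mu)$, $|y|\le|x|$ imply $y\in X$. A Banach ideal space on $(\Omega,\mathscr F,\mu)$ is a solid subspace $X$ of $L^0(\mu)$ equipped with a norm $\|\cdot\|$ which is monotone ($\|x\|\le\|y\|$ whenever $x,y\in X$, $|x|\le|y|$) and with respect to which $X$ is complete. $X_+=\{x\in X:x\ge 0\}$; $X'$ is the topological dual of $X$; $\langle x,g\rangle:=g(x)$ for $x\in X$, $g\in X'$. An element $g\in X'$ is called strictly positive if $\langle x,g\rangle>0$ for all $x\in X_+\setminus\{0\}$. *)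

(* Defs.v *)
From HB Require Import structures.
From mathcomp Require Import all_boot all_order all_algebra.
From mathcomp Require Import all_classical all_reals all_analysis.
From mathcomp Require Import measurable_realfun.

Set Implicit Arguments.
Unset Strict Implicit.
Unset Printing Implicit Defensive.

Import Order.TTheory GRing.Theory Num.Def Num.Theory.
Import numFieldNormedType.Exports.

Local Open Scope classical_set_scope.
Local Open Scope ring_scope.
Local Open Scope quotient_scope.

(* Elements are classes of everywhere finite measurable functions: an a.e.
   finite measurable function has such a representative. *)
Definition L0 d (T : measurableType d) (R : realType)
    (mu : {measure set T -> \bar R}) : Type :=
  {mfun_ mu, T >-> R}.

Section L0_theory.
Context d (T : measurableType d) (R : realType).
Variable mu : {measure set T -> \bar R}.
Local Notation M := {mfun T >-> R}.
Local Notation L := (L0 mu).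

HB.instance Definition _ := Choice.on L.
HB.instance Definition _ := EqQuotient.on L.

Definition class_L0 (f : M) : L := \pi_L f.
Definition repr_L0 (x : L) : M := repr x.

Lemma repr_L0K : cancel repr_L0 class_L0.
Proof. exact: reprK. Qed.

Lemma class_L0P (f g : M) : class_L0 f = class_L0 g <-> f = g %[ae mu].
Proof.
split=> [/eqmodP/asboolP //|fg].
by apply/eqmodP/asboolP.
Qed.

Lemma class_L0K (f : M) : repr_L0 (class_L0 f) = f %[ae mu].
Proof. by apply/class_L0P; rewrite repr_L0K. Qed.

Definition zero_L0 : L := class_L0 0.
Definition add_L0 (x y : L) : L := class_L0 (repr_L0 x + repr_L0 y).
Definition opp_L0 (x : L) : L := class_L0 (- repr_L0 x).
Definition scale_L0 (a : R) (x : L) : L := class_L0 (a *: repr_L0 x).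
Definition abs_L0 (x : L) : L := class_L0 (normr \o repr_L0 x : M).

Lemma add_L0E (f g : M) : add_L0 (class_L0 f) (class_L0 g) = class_L0 (f + g).
Proof.
apply/class_L0P.
apply: filterS2 (class_L0K f) (class_L0K g) => t ff gg _.
by congr (_ + _); [exact: ff|exact: gg].
Qed.

Lemma opp_L0E (f : M) : opp_L0 (class_L0 f) = class_L0 (- f).
Proof.
apply/class_L0P.
by apply: filterS (class_L0K f) => t ff _; congr (- _); exact: ff.
Qed.

Lemma scale_L0E a (f : M) : scale_L0 a (class_L0 f) = class_L0 (a *: f).
Proof.
apply/class_L0P.
by apply: filterS (class_L0K f) => t ff _; congr (_ * _); exact: ff.
Qed.

Lemma abs_L0E (f : M) : abs_L0 (class_L0 f) = class_L0 (normr \o f : M).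
Proof.
apply/class_L0P.
by apply: filterS (class_L0K f) => t ff _; congr `|_|; exact: ff.
Qed.

Lemma class_L0_surj (x : L) : exists f, x = class_L0 f.
Proof. by exists (repr_L0 x); rewrite repr_L0K. Qed.

Let add_L0A : associative add_L0.
Proof.
move=> x y z.
have [f ->] := class_L0_surj x; have [g ->] := class_L0_surj y.
by have [h ->] := class_L0_surj z; rewrite !add_L0E addrA.
Qed.

Let add_L0C : commutative add_L0.
Proof.
move=> x y.
have [f ->] := class_L0_surj x; have [g ->] := class_L0_surj y.
by rewrite !add_L0E addrC.
Qed.

Let add_0L0 : left_id zero_L0 add_L0.
Proof. by move=> x; have [f ->] := class_L0_surj x; rewrite add_L0E add0r. Qed.

Let add_NL0 : left_inverse zero_L0 opp_L0 add_L0.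
Proof.
by move=> x; have [f ->] := class_L0_surj x; rewrite opp_L0E add_L0E addNr.
Qed.

HB.instance Definition _ :=
  GRing.isZmodule.Build L add_L0A add_L0C add_0L0 add_NL0.

Let scale_L0A a b (x : L) : scale_L0 a (scale_L0 b x) = scale_L0 (a * b) x.
Proof.
by have [f ->] := class_L0_surj x; rewrite !scale_L0E scalerA.
Qed.

Let scale_1L0 : left_id 1 scale_L0.
Proof. by move=> x; have [f ->] := class_L0_surj x; rewrite scale_L0E scale1r. Qed.

Let scale_L0Dr : right_distributive scale_L0 +%R.
Proof.
move=> a x y.
have [f ->] := class_L0_surj x; have [g ->] := class_L0_surj y.
by rewrite [_ + _]add_L0E !scale_L0E [RHS]add_L0E scalerDr.
Qed.

Let scale_L0Dl (x : L) : {morph scale_L0^~ x : a b / a + b}.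
Proof.
move=> a b; have [f ->] := class_L0_surj x.
by rewrite !scale_L0E [RHS]add_L0E scalerDl.
Qed.

HB.instance Definition _ := GRing.Zmodule_isLmodule.Build R L
  scale_L0A scale_1L0 scale_L0Dr scale_L0Dl.

Definition le_L0 (x y : L) : bool :=
  `[< \forall t \ae mu, repr_L0 x t <= repr_L0 y t >].

Lemma le_L0E (f g : M) :
  le_L0 (class_L0 f) (class_L0 g) <-> \forall t \ae mu, f t <= g t.
Proof.
split=> [/asboolP|] fg; last apply/asboolP.
- by apply: filterS3 fg (class_L0K f) (class_L0K g) => t + <-// <-.
- by apply: filterS3 fg (class_L0K f) (class_L0K g) => t + ->// ->.
Qed.

Let le_L0_refl : reflexive le_L0.
Proof. by move=> x; apply/asboolP; exact: aeW. Qed.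

Let le_L0_anti : antisymmetric le_L0.
Proof.
move=> x y /andP[/asboolP xy /asboolP yx].
rewrite -(repr_L0K x) -(repr_L0K y); apply/class_L0P.
by apply: filterS2 xy yx => t xy yx _; apply/eqP; rewrite eq_le xy.
Qed.

Let le_L0_trans : transitive le_L0.
Proof.
move=> y x z /asboolP xy /asboolP yz; apply/asboolP.
by apply: filterS2 xy yz => t; exact: le_trans.
Qed.

HB.instance Definition _ := Order.Le_isPOrder.Build ring_display L
  le_L0_refl le_L0_anti le_L0_trans.

Lemma L0_ge0P (f : M) : 0 <= class_L0 f <-> \forall t \ae mu, 0 <= f t.
Proof. exact: (le_L0E 0 f). Qed.

End L0_theory.

(* [X] is the subspace [\val @` X = [set` S]] of [L0 mu] with its own norm. *)
HB.mixin Record isBanachIdeal d (T : measurableType d) (R : realType)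
    (mu : {measure set T -> \bar R}) (S : pred (L0 mu)) (X : Type)
    of @GRing.SubLmodule R (L0 mu) S X & CompleteNormedModule R X := {
  ideal_solid : forall x y : L0 mu, S x -> abs_L0 y <= abs_L0 x -> S y ;
  ideal_norm_monotone : forall x y : X,
    abs_L0 (\val x) <= abs_L0 (\val y) -> `|x| <= `|y| }.

#[short(type="banachIdealType")]
HB.structure Definition BanachIdeal d (T : measurableType d) (R : realType)
    (mu : {measure set T -> \bar R}) (S : pred (L0 mu)) :=
  { X of @GRing.SubLmodule R (L0 mu) S X & CompleteNormedModule R X
       & isBanachIdeal d T R mu S X }.

Section Kreps_Yan.
Context d (T : measurableType d) (R : realType).
Variables (mu : {measure set T -> \bar R}) (S : pred (L0 mu)).
Variable X : banachIdealType S.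

Definition nneg_cone : set X := [set x | 0 <= \val x :> L0 mu].

Definition convex_cone (C : set X) :=
  convex_set C /\ forall (t : R) x, 0 <= t -> C x -> C (t *: x).

Definition strictly_positive (g : X -> R) :=
  forall x, nneg_cone x -> x != 0 -> 0 < g x.

Definition Kreps_Yan_property :=
  forall C : set X, closed C -> convex_cone C ->
    C `&` nneg_cone = [set 0] -> -%R @` nneg_cone `<=` C ->
    exists g : {linear X -> R^o},
      [/\ continuous g, strictly_positive g & forall x, C x -> g x <= 0].

End Kreps_Yan.

(* Main.v *)
Require Import Defs.
From HB Require Import structures.
From mathcomp Require Import all_boot all_order all_algebra.
From mathcomp Require Import all_classical all_reals all_analysis.
From mathcomp Require Import measurable_realfun.
From mathcomp Require Import ring lra.
(* Since -X_+ is contained in C, the distance p to C is a sublinear, monotone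
   function on X, and p x = 0 with x >= 0 forces x = 0. Linear functionals below
   p are exactly the elements of the unit ball of X' that are nonpositive on C.
   Let mu(A) be finite and e > 0. On the convex set K(A, e) of those x in X with
   0 <= x <= 1_A and integral at least e, p is bounded below by some c > 0: if p
   were small along a sequence, p would be summably small on sets B_n of measure
   bounded below, hence small on finite unions of them, and a nonnull set
   contained in tails of such unions would have an indicator in C. Hahn-Banach
   (in the Mazur-Orlicz form) yields g <= p with g >= c on K(A, e). Weighted sums
   of countably many such g, over e = 1/n and over countably many sets A
   exhausting the supports of the elements of X, are strictly positive. *)

Set Implicit Arguments.
Unset Strict Implicit.
Unset Printing Implicit Defensive.

Import Order.TTheory GRing.Theory Num.Theory.
Import numFieldNormedType.Exports.
Local Open Scope classical_set_scope.
Local Open Scope ring_scope.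

(** * Sublinear functions and the Hahn-Banach theorem *)

Section Sublinear.
Context (R : realType) (V : lmodType R).

Definition sublinear (p : V -> R) :=
  (forall x y, p (x + y) <= p x + p y) /\
  (forall t x, 0 <= t -> p (t *: x) = t * p x).

Lemma sublinear0 p : sublinear p -> p 0 = 0.
Proof. by move=> [_ pZ]; rewrite -(scale0r 0) pZ// mul0r. Qed.

Lemma sublinear_geN p : sublinear p -> forall x, - p (- x) <= p x.
Proof.
move=> sp x; rewrite lerNl -subr_ge0 opprK -(sublinear0 sp).
by rewrite -(addNr x) sp.1.
Qed.

(** Applying the inequality to [t^-1] and [t *: x] gives the reverse one. *)
Lemma sublinearW p :
  (forall x y, p (x + y) <= p x + p y) -> p 0 = 0 ->
  (forall t x, 0 < t -> p (t *: x) <= t * p x) -> sublinear p.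
Proof.
move=> pD p0 pZ; split=> // t x; rewrite le_eqVlt => /predU1P[<-|t0].
  by rewrite scale0r p0 mul0r.
have tn0 : t != 0 by rewrite gt_eqF.
apply/eqP; rewrite eq_le pZ//= -ler_pdivlMl//.
by rewrite -[x in leLHS](scalerK tn0) pZ ?invr_gt0.
Qed.

(** Take for [q x] the infimum of [p (x + t *: k) - t * c] over [t >= 0] and [k] in [K]. It is
    finite because [t * c <= p (t *: k) <= p (x + t *: k) + p (- x)], and [t = 1] bounds it at
    [- k]. A singleton [K] serves for Hahn-Banach, a general one for its Mazur-Orlicz form. *)
Lemma sublinear_shift p (K : set V) (c : R) : sublinear p -> K !=set0 ->
  (forall s t x y, 0 <= s -> 0 <= t -> s + t = 1 -> K x -> K y ->
    K (s *: x + t *: y)) ->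
  (forall k, K k -> c <= p k) ->
  exists q : V -> R, [/\ sublinear q, forall x, q x <= p x &
    forall k, K k -> q (- k) <= - c].
Proof.
move=> sp [k0 Kk0] convK pc.
pose E x := [set r | exists t k, [/\ 0 <= t, K k & r = p (x + t *: k) - t * c]].
have Elb x : lbound (E x) (- p (- x)).
  move=> _ [t [k [t0 Kk ->]]].
  have : p (t *: k) <= p (x + t *: k) + p (- x).
    by rewrite -[in leLHS](addKr x (t *: k)) addrC sp.1.
  have : t * c <= t * p k by rewrite ler_wpM2l ?pc.
  rewrite sp.2//; lra.
have hE x : has_lbound (E x) by exists (- p (- x)).
have E0 x : E x !=set0 by exists (p (x + 0 *: k0) - 0 * c), 0, k0.
have Ele x t k : 0 <= t -> K k -> inf (E x) <= p (x + t *: k) - t * c.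
  by move=> t0 Kk; apply: ge_inf => //; exists t, k.
have Ep x : inf (E x) <= p x.
  by have := Ele x 0 k0 (lexx _) Kk0; rewrite scale0r addr0 mul0r subr0.
exists (fun x => inf (E x)); split=> //.
- apply: sublinearW => [x y||t x t0].
  + rewrite -lerBlDr; apply: lb_le_inf => // _ [s [k [s0 Kk ->]]].
    rewrite lerBlDr -lerBlDl; apply: lb_le_inf => // _ [t [l [t0 Kl ->]]].
    rewrite lerBlDl.
    (* By convexity the two shifts merge into one multiple of a point of [K]; when [s + t = 0] both
       vanish and any point will do. *)
    have [m Km mE] : exists2 m, K m & s *: k + t *: l = (s + t) *: m.
      have [st0|st0] := eqVneq (s + t) 0.
        exists k0 => //.
        have [-> ->] : s = 0 /\ t = 0 by lra.
        by rewrite addr0 !scale0r addr0.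
      exists ((s / (s + t)) *: k + (t / (s + t)) *: l).
        by apply: convK => //; rewrite ?divr_ge0 ?addr_ge0// -mulrDl divff.
      by rewrite scalerDr !scalerA ![(s + t) * _]mulrC !divfK.
    apply: (le_trans (Ele _ _ _ (addr_ge0 s0 t0) Km)).
    have := sp.1 (x + s *: k) (y + t *: l).
    rewrite addrACA mE; lra.
  + apply/eqP; rewrite eq_le; apply/andP; split.
      by rewrite -(sublinear0 sp).
    apply: lb_le_inf => // r /Elb; apply: le_trans.
    by rewrite oppr0 (sublinear0 sp) oppr0.
  + rewrite -ler_pdivrMl//; apply: lb_le_inf => // _ [s [k [s0 Kk ->]]].
    rewrite ler_pdivrMl//.
    apply: (le_trans (Ele (t *: x) (t * s) k _ Kk)).
      by rewrite mulr_ge0// ltW.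
    by rewrite -scalerA -scalerDr sp.2 ?(ltW t0)// mulrBr mulrA.
- move=> k Kk; apply: (le_trans (Ele _ 1 k ler01 Kk)).
  by rewrite scale1r addNr (sublinear0 sp) mul1r sub0r.
Qed.

(* A minimal sublinear function below [p] is linear. *)
Lemma hahn_banach p : sublinear p ->
  exists g : {linear V -> R^o}, forall x, g x <= p x.
Proof.
move=> sp.
pose below (q : V -> R) := sublinear q /\ forall x, q x <= p x.
pose F := {q | below q}.
(* The order is reversed, so that maximality in Zorn's lemma means minimality of the function. *)
pose rF : rel F := fun f h => `[< forall x, sval h x <= sval f x >].
have pF : F by exists p.
have [||A Atot|[q [sq qp]] qmin] := ZL_preorder pF (R := rF).
- by move=> q; apply/asboolP.
- move=> q1 q2 q3 /= /asboolP h1 /asboolP h2; apply/asboolP => x.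
  exact: le_trans (h2 x) (h1 x).
- have [[q0 Aq0]|A0] := pselect (A !=set0); last first.
    by exists pF => s As; case: A0; exists s.
  pose E x := [set sval f x | f in A].
  have Elb x : lbound (E x) (- p (- x)).
    move=> _ [[q [sq qp]] Aq <-] /=.
    by apply: le_trans (sublinear_geN sq x); rewrite lerN2.
  have hE x : has_lbound (E x) by exists (- p (- x)).
  have E0 x : E x !=set0 by exists (sval q0 x), q0.
  have Ele x q : A q -> inf (E x) <= sval q x.
    by move=> Aq; apply: ge_inf => //; exists q.
  have sE : sublinear (fun x => inf (E x)) /\ forall x, inf (E x) <= p x.
    split; last by move=> x; apply: le_trans (Ele x q0 Aq0) ((svalP q0).2 x).
    apply: sublinearW => [x y||t x t0].
    + rewrite -lerBlDr; apply: lb_le_inf => // _ [q1 Aq1 <-].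
      rewrite lerBlDr -lerBlDl; apply: lb_le_inf => // _ [q2 Aq2 <-].
      rewrite lerBlDl.
      (* On a chain the smaller of [q1] and [q2] can be used at [x] and [y] at once, so the
         pointwise infimum is subadditive. *)
      have [/asboolP h|/asboolP h] := Atot _ _ Aq1 Aq2.
      * apply: (le_trans (Ele _ _ Aq2)); apply: (le_trans ((svalP q2).1.1 _ _)).
        by rewrite lerD2r.
      * apply: (le_trans (Ele _ _ Aq1)); apply: (le_trans ((svalP q1).1.1 _ _)).
        by rewrite lerD2l.
    + apply/eqP; rewrite eq_le; apply/andP; split.
        by rewrite -(sublinear0 (svalP q0).1) Ele.
      apply: lb_le_inf => // r /Elb; apply: le_trans.
      by rewrite oppr0 (sublinear0 sp) oppr0.
    + rewrite -ler_pdivrMl//; apply: lb_le_inf => // _ [q Aq <-].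
      rewrite ler_pdivrMl// -((svalP q).1.2 _ _ (ltW t0)); exact: Ele.
  exists (exist below _ sE) => q Aq; apply/asboolP => x /=; exact: Ele.
(* Shifting [q] along [[set a]] gives [q' <= q] with [q' (- a) <= - q a]. Minimality turns this into
   [q (- a) <= - q a], and subadditivity at [x + a] and [- a] yields the missing inequality. *)
have qD a x : q (x + a) = q x + q a.
  apply/eqP; rewrite eq_le sq.1/=.
  have [||_ ->//|q' [sq' q'q q'a]] := @sublinear_shift q [set a] (q a) sq.
  + by exists a.
  + by move=> s t _ _ _ _ st -> ->; rewrite /= -scalerDl st scale1r.
  have q'p y : q' y <= p y by apply: le_trans (q'q y) (qp y).
  have /asboolP/= h := qmin (exist below _ (conj sq' q'p)) (asboolT q'q).
  have /= := q'a a erefl.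
  have := h (- a); have := sq.1 (x + a) (- a); rewrite addrK; lra.
have qN x : q (- x) = - q x.
  by apply/eqP; rewrite -addr_eq0 -qD addNr (sublinear0 sq).
have qlin : linear (q : V -> R^o).
  move=> t x y; rewrite qD; congr (_ + _).
  have [t0|/ltW t0] := leP 0 t; first exact: sq.2.
  rewrite -[t *: x]opprK -scaleNr qN sq.2 ?oppr_ge0//.
  by rewrite mulNr opprK.
pose L := GRing.isLinear.Build R V R^o _ (q : V -> R^o) qlin.
pose g : {linear V -> R^o} := HB.pack (q : V -> R^o) L.
by exists g.
Qed.

Lemma hahn_banach_convex p (K : set V) (c : R) : sublinear p -> K !=set0 ->
  (forall s t x y, 0 <= s -> 0 <= t -> s + t = 1 -> K x -> K y ->
    K (s *: x + t *: y)) ->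
  (forall k, K k -> c <= p k) ->
  exists g : {linear V -> R^o},
    (forall x, g x <= p x) /\ (forall k, K k -> c <= g k).
Proof.
move=> sp K0 convK pc.
have [q [sq qp qK]] := sublinear_shift sp K0 convK pc.
have [g gq] := hahn_banach sq; exists g; split=> [x|k Kk].
  exact: le_trans (gq x) (qp x).
by rewrite -lerN2 -linearN; apply: le_trans (gq _) (qK _ Kk).
Qed.

(** The functional is a series of the [g n] with positive weights of sum 1, hence still below [p].
    If [p (- x) <= 0], every [g n x] is nonnegative, so a positive term cannot be cancelled. *)
Lemma sublinear_countable_sum (p : V -> R) (g : nat -> {linear V -> R^o}) :
  sublinear p -> (forall n x, g n x <= p x) ->
  exists h : {linear V -> R^o}, (forall x, h x <= p x) /\
    forall x, p (- x) <= 0 -> (exists n, 0 < g n x) -> 0 < h x.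
Proof.
move=> sp gp.
pose w : R^nat := geometric 2^-1 2^-1.
have w0 n : 0 < w n by rewrite mulr_gt0// ?exprn_gt0 ?invr_gt0.
have half1 : `|2^-1 : R| < 1 by rewrite ger0_norm ?invr_ge0//; lra.
have wcvg : series w @ \oo --> (1 : R).
  rewrite (_ : 1 = 2^-1 / (1 - 2^-1) :> R); first exact: cvg_geometric_series.
  by field.
pose u x : R^nat := fun n => w n * g n x.
have ucvg x : cvgn (series (u x)).
  (* [M] dominates every [|g n x|], since [- p (- x) <= g n x <= p x]; the same bounds give
     [0 <= M]. *)
  apply: normed_cvg; pose M := Num.max (p x) (p (- x)).
  apply: (@series_le_cvg _ _ (fun n => w n * M)).
  - by move=> n; exact: normr_ge0.
  - move=> n; rewrite mulr_ge0 ?(ltW (w0 n))// le_max.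
    have := gp 0%N x; have := gp 0%N (- x); rewrite linearN.
    have [//|h1 h2] := leP 0 (p x); lra.
  - move=> n; rewrite /u /= normrM gtr0_norm// ler_pM2l//.
    rewrite ler_norml le_max gp/= andbT.
    by rewrite lerNl le_max -linearN gp orbT.
  - rewrite (_ : (fun _ => _) = M *: w); last by apply/funext => n; rewrite mulrC.
    by apply: is_cvg_seriesZ; apply/cvg_ex; exists 1.
have ulin : linear (fun x => limn (series (u x)) : R^o).
  move=> a x y; have -> : u (a *: x + y) = a *: u x + u y.
    apply/funext => n; rewrite /u /= linearP mulrDr; congr (_ + _).
    by rewrite mulrCA.
  have aucvg : cvgn (series (a *: u x : R^nat)) by exact: is_cvg_seriesZ.
  by rewrite [LHS](lim_seriesD aucvg (ucvg y)) (lim_seriesZ _ (ucvg x)).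
pose h : {linear V -> R^o} := HB.pack (fun x => limn (series (u x)) : R^o)
  (GRing.isLinear.Build R V R^o _ _ ulin).
exists h; split=> [x|x px [n gn0]].
- have wp : series (p x *: w) @ \oo --> p x.
    by rewrite seriesZ -[X in _ --> X]mulr1; apply: cvgZr.
  rewrite -(cvg_lim _ wp)//; apply: ler_lim => //.
    by apply/cvg_ex; eexists; exact: wp.
  apply: nearW => n; apply: ler_sum => i _.
  by rewrite /u /= mulrC ler_pM2r.
- have g0 m : 0 <= g m x by rewrite -oppr_le0 -linearN (le_trans (gp m _)).
  have u0 m : 0 <= u x m by rewrite mulr_ge0// ltW.
  apply: (@lt_le_trans _ _ (series (u x) n.+1)).
    by rewrite seriesSr ltr_wpDl ?sumr_ge0// mulr_gt0.
  apply: nondecreasing_cvgn_le => //.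
  by apply/nondecreasing_seqP => m; rewrite seriesSr lerDl.
Qed.

End Sublinear.

(** * The distance to a convex cone *)

Section ConeDistance.
Context (R : realType) (V : normedModType R) (C : set V).
Hypothesis C0 : C 0.
Hypothesis CD : forall x y, C x -> C y -> C (x + y).
Hypothesis CZ : forall (t : R) x, 0 <= t -> C x -> C (t *: x).

Definition cone_dist (x : V) : R := inf [set `|x - c| | c in C].

Let dist_ge0 x : lbound [set `|x - c| | c in C] 0.
Proof. by move=> _ [c _ <-]. Qed.

Let dist_neq0 x : [set `|x - c| | c in C] !=set0.
Proof. by exists `|x - 0|, 0. Qed.

Lemma cone_dist_le x c : C c -> cone_dist x <= `|x - c|.
Proof.
by move=> Cc; apply: ge_inf; [exists 0; exact: dist_ge0|exists c].
Qed.

Lemma cone_dist_le0 x : C x -> cone_dist x <= 0.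
Proof. by move=> Cx; rewrite (le_trans (cone_dist_le _ Cx))// subrr normr0. Qed.

Lemma cone_dist_le_norm x : cone_dist x <= `|x|.
Proof. by have := cone_dist_le x C0; rewrite subr0. Qed.

Lemma cone_dist_sublinear : sublinear cone_dist.
Proof.
apply: sublinearW => [x y||t x t0].
- rewrite -lerBlDr; apply: lb_le_inf => // _ [c Cc <-].
  rewrite lerBlDr -lerBlDl; apply: lb_le_inf => // _ [e Ce <-].
  rewrite lerBlDl (le_trans (cone_dist_le _ (CD Cc Ce)))//.
  by rewrite opprD addrACA ler_normD.
- apply/eqP; rewrite eq_le cone_dist_le0//=.
  exact: lb_le_inf (dist_neq0 0) (@dist_ge0 0).
- rewrite -ler_pdivrMl//; apply: lb_le_inf => // _ [c Cc <-].
  rewrite ler_pdivrMl// (le_trans (cone_dist_le _ (CZ (ltW t0) Cc)))//.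
  by rewrite -scalerBr normrZ gtr0_norm.
Qed.

Lemma cone_dist_closed x : closed C -> cone_dist x <= 0 -> C x.
Proof.
move=> clC x0; apply: clC => B /nbhs_normP[e /= e0 xeB].
have hi : has_inf [set `|x - c| | c in C].
  by split=> //; exists 0; exact: dist_ge0.
have [_ [c Cc <-] xc] := inf_adherent e0 hi.
exists c; split=> //; apply: xeB => /=.
by apply: (lt_le_trans xc); rewrite gerDr.
Qed.

End ConeDistance.

(** * Exhaustion and upper limits of sets *)

Section MeasureLemmas.
Context d (T : measurableType d) (R : realType).
Variable mu : {measure set T -> \bar R}.
Local Open Scope ereal_scope.

Lemma lt_natSinv (x : \bar R) : 0 < x -> exists n : nat, (n.+1%:R^-1)%:E < x.
Proof.
case: x => [r|_|//]; last by exists 0%N; rewrite ltry.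
rewrite lte_fin => r0.
have [n _ /(_ n (leqnn n)) nr] := near_infty_natSinv_lt (PosNum r0).
by exists n; rewrite lte_fin.
Qed.

Lemma measure_bigcup_neq0 (F : nat -> set T) :
  (forall n, measurable (F n)) -> mu (\bigcup_n F n) != 0 ->
  exists n, mu (F n) != 0.
Proof.
move=> mF; apply: contra_neqP => /forallNP F0.
apply/eqP; rewrite eq_le measure_ge0 andbT.
apply: (@le_trans _ _ (\sum_(i <oo) mu (F i))).
  by apply: measure_sigma_subadditive => //; exact: bigcup_measurable.
by rewrite eseries0// => i _ _; apply/eqP/negP => /negP /F0.
Qed.

(* Each [A n] has nearly maximal measure among the traces of [P] on some set of
   finite measure; adjoining to it a nonnull [B] missing every [A n] would exceed
   the supremum. *)
Lemma sigma_finite_exhaustion (P : set (set T)) :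
  sigma_finite setT mu -> P set0 ->
  (forall A, P A -> measurable A) ->
  (forall A B, P A -> P B -> P (A `|` B)) ->
  exists A : nat -> set T,
    [/\ forall n, measurable (A n),
        forall n, mu (A n) < +oo &
        forall B, P B -> mu B != 0 -> exists n, mu (B `&` A n) != 0].
Proof.
move=> [F FT mF] P0 mP PU.
pose s n := ereal_sup [set mu (A `&` F n) | A in P].
have sub n A : P A -> mu (A `&` F n) <= s n.
  by move=> PA; apply: ereal_sup_ubound; exists A.
have sle n : s n <= mu (F n).
  apply: ge_ereal_sup => _ [A PA <-]; apply: le_measure; rewrite ?inE//.
  - by apply: measurableI; [exact: mP|exact: (mF n).1].
  - exact: (mF n).1.
have s_fin n : s n \is a fin_num.
  rewrite ge0_fin_numE; first exact: le_lt_trans (sle n) (mF n).2.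
  by apply: le_trans (sub n _ P0).
have /choice[A AP] : forall nk : nat * nat, exists A, P A /\
    s nk.1 - (nk.2.+1%:R^-1)%:E < mu (A `&` F nk.1).
  move=> [n k]; have k0 : (0 < k.+1%:R^-1 :> R)%R by rewrite invr_gt0.
  by have [_ [A PA <-] sA] := ub_ereal_sup_adherent k0 (s_fin n); exists A.
pose G nk := A nk `&` F nk.1.
have mG nk : measurable (G nk).
  by apply: measurableI; [exact: mP (AP _).1|exact: (mF _).1].
have mB' B n : P B -> measurable (B `&` F n).
  by move=> PB; apply: measurableI; [exact: mP|exact: (mF _).1].
have Gub nk : mu (G nk) <= mu (F nk.1).
  by apply: le_trans (sle _); apply: sub; exact: (AP _).1.
(* The pairs [(n, k)] are enumerated by their codes; an index that codes no pair falls back on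
   [(0, 0)], which only repeats a set. *)
exists (fun i => G (odflt (0, 0)%N (unpickle i))); split=> [//|i|B PB B0].
  exact: le_lt_trans (Gub _) (mF _).2.
have [n BF] : exists n, mu (B `&` F n) != 0.
  apply: measure_bigcup_neq0; first by move=> n; exact: mB'.
  by rewrite -setI_bigcupr -FT setIT.
have BF0 : 0 < mu (B `&` F n) by rewrite lt0e BF measure_ge0.
(* This [k] makes the gap between [s n] and the measure of [G (n, k)] smaller than the measure of
   the trace of [B] on [F n]. *)
have [k kB] := lt_natSinv BF0.
exists (pickle (n, k)); rewrite pickleK /=; apply/eqP => BG0.
have := sub n _ (PU _ _ PB (AP (n, k)).1).
apply/negP; rewrite -ltNge setIUl -/(G (n, k)).
have mBF : measurable (B `&` F n) by exact: mB'.
have BFG : mu (B `&` F n) = mu ((B `&` F n) `\` G (n, k)).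
  rewrite (measureDI mu mBF (mG (n, k))) -[RHS]adde0; congr (_ + _).
  apply/eqP; rewrite eq_le measure_ge0 andbT -BG0.
  apply: le_measure; rewrite ?inE.
  - exact: measurableI.
  - by apply: measurableI => //; exact: mP.
  - by apply: setSI; exact: subIsetl.
have -> : (B `&` F n) `|` G (n, k) = ((B `&` F n) `\` G (n, k)) `|` G (n, k).
  by rewrite setDE [RHS]setUIl setUCl setIT.
rewrite measureU//; [|exact: measurableD|by rewrite setIC setDIK].
rewrite -[X in X + _]BFG addeC.
apply: (@lt_le_trans _ _ (mu (G (n, k)) + (k.+1%:R^-1)%:E)).
  by rewrite -lteBlDr//; exact: (AP (n, k)).2.
by rewrite leeD2l// ltW.
Qed.

(* Truncating the unions in [limsup B] loses at most [e / 2] of its measure. *)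
Lemma measure_limsup_core (A : set T) (B : nat -> set T) (e : R) :
  measurable A -> mu A < +oo -> (forall n, measurable (B n)) ->
  (forall n, B n `<=` A) -> (0 < e)%R -> (forall n, e%:E <= mu (B n)) ->
  exists m : nat -> nat,
    mu (\bigcap_n \big[setU/set0]_(i < (m n).+1) B (n + i)%N) != 0.
Proof.
move=> mA Afin mB BA e0 eB.
pose D n := \bigcup_i B (n + i)%N.
pose U n j := \big[setU/set0]_(i < j.+1) B (n + i)%N.
have mD n : measurable (D n) by exact: bigcup_measurable.
have mU n j : measurable (U n j) by exact: bigsetU_measurable.
have DA n : D n `<=` A by apply: bigcup_sub => i _.
have finA E : measurable E -> E `<=` A -> mu E < +oo.
  by move=> mE EA; apply: le_lt_trans Afin; apply: le_measure; rewrite ?inE.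
(* The remainders [D n] minus [U n j] decrease to the empty set inside a set of finite measure; the
   chosen errors sum to [e / 2]. *)
have /choice[m mP] : forall n, exists j,
    mu (D n `\` U n j) <= (e / 2 / (2 ^ n.+1)%:R)%:E.
  move=> n.
  have cap0 : \bigcap_j (D n `\` U n j) = set0.
    apply/seteqP; split=> // t Dt; have [i _ Bt] := (Dt 0%N I).1.
    have := (Dt i I).2; apply.
    by rewrite /U -(bigcup_mkord i.+1 (fun i => B (n + i)%N)); exists i => /=.
  have := @nonincreasing_cvg_mu _ _ _ mu (fun j => D n `\` U n j).
  rewrite cap0 measure0 => h.
  have {}h : mu \o (fun j => D n `\` U n j) @ \oo --> 0.
    apply: h => //.
    - by apply: finA; [exact: measurableD|move=> t [/DA]].
    - by move=> j; exact: measurableD.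
    - move=> i j ij; apply/subsetPset => t [Dt nUt]; split=> // Ut.
      apply: nUt.
      exact: (@subset_bigsetU _ (fun i => B (n + i)%N) i.+1 j.+1 ij) Ut.
  have e'0 : (0 < e / 2 / (2 ^ n.+1)%:R)%R.
    by rewrite !divr_gt0// ltr0n expn_gt0.
  have [j _ /(_ j (leqnn j)) je] := h _ (nbhs_open_ereal_lt (f := fun=> _) e'0).
  by exists j; exact: ltW.
exists m; apply/eqP => E0.
pose E := \bigcap_n U n (m n).
pose L := \bigcap_n D n.
have mL : measurable L by exact: bigcap_measurable.
have mE : measurable E by exact: bigcap_measurable.
(* Continuity from above on the decreasing [D n], each of which contains [B n]. *)
have eL : e%:E <= mu L.
  have niD : nonincreasing_seq D.
    move=> i j ij; apply/subsetPset => t [k _ Bt].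
    by exists (j - i + k)%N => //; rewrite addnA subnKC.
  have Dcvg := nonincreasing_cvg_mu (finA _ (mD 0%N) (DA 0%N)) mD mL niD.
  apply: (cvge_to_ge Dcvg); apply: nearW => n; apply: le_trans (eB n) _.
  apply: le_measure; rewrite ?inE// => t Bt.
  by exists 0%N => //; rewrite addn0.
have LE : L `\` E `<=` \bigcup_n (D n `\` U n (m n)).
  move=> t [Lt Et]; have [n nEt] : exists n, ~ U n (m n) t.
    by apply/existsNP => h; apply: Et => n _.
  by exists n => //; split=> //; exact: Lt.
have : mu L <= (e / 2)%:E.
  rewrite (measureDI mu mL mE) [X in _ + X](_ : _ = 0); last first.
    apply/eqP; rewrite eq_le measure_ge0 andbT -E0.
    by apply: le_measure; rewrite ?inE//; exact: measurableI.
  rewrite adde0; apply: (@le_trans _ _ (\sum_(n <oo) mu (D n `\` U n (m n)))).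
    apply: measure_sigma_subadditive => //; last exact: measurableD.
    by move=> n; exact: measurableD.
  have e2 : (0 <= e / 2)%R by rewrite divr_ge0// ltW.
  by apply: le_trans (epsilon_trick0 xpredT e2); exact: lee_nneseries.
rewrite leNgt (lt_le_trans _ eL)// lte_fin ltr_pdivrMr//; lra.
Qed.
End MeasureLemmas.

(** * Elements of a Banach ideal space and their representatives *)

Section BanachIdealFunctional.
Context d (T : measurableType d) (R : realType).
Variables (mu : {measure set T -> \bar R}) (S : pred (L0 mu)).
Variable X : banachIdealType S.
Local Notation M := {mfun T >-> R}.

Lemma nneg_coneB (x y : X) (f h : M) : \val x = class_L0 mu f ->
  \val y = class_L0 mu h -> (forall t, f t <= h t) -> nneg_cone (y - x).
Proof.
move=> xf yh fh; rewrite /nneg_cone /= raddfB /= xf yh.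
have -> : class_L0 mu h - class_L0 mu f = class_L0 mu (h - f).
  by rewrite [- _]opp_L0E [LHS]add_L0E.
by apply/L0_ge0P/aeW => t; have := fh t; rewrite -subr_ge0.
Qed.

Lemma ideal_sub_class (x : X) (f h : M) : \val x = class_L0 mu h ->
  (forall t, 0 <= f t <= h t) ->
  exists2 y : X, \val y = class_L0 mu f & nneg_cone (x - y).
Proof.
move=> xh fh; have Sf : S (class_L0 mu f).
  apply: (ideal_solid (s := X) (\val x)); first exact: valP.
  rewrite xh !abs_L0E; apply/le_L0E/aeW => t /=.
  by have /andP[f0 ft] := fh t; rewrite !ger0_norm// (le_trans f0).
exists (Sub _ Sf); first by rewrite SubK.
by apply: nneg_coneB xh _; [rewrite SubK|move=> t; have /andP[] := fh t].
Qed.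

(** The positive part of a representative is again one, and it is nonnegative everywhere. *)
Lemma nneg_cone_class (x : X) : nneg_cone x ->
  exists2 f : M, \val x = class_L0 mu f & forall t, 0 <= f t.
Proof.
move=> x0; exists (repr_L0 (\val x) \max (0 : M) : M); last first.
  by move=> t /=; rewrite le_max lexx orbT.
move: x0; rewrite /nneg_cone /= -{1 2}(repr_L0K (\val x)) => /L0_ge0P x0.
by apply/class_L0P; apply: filterS x0 => t /= ? _; rewrite max_l.
Qed.

Lemma class_L0_eq0 (f : M) : class_L0 mu f = 0 -> mu [set t | f t != 0] = 0%E.
Proof.
move=> /(class_L0P mu f 0).1 f0.
have mf : measurable [set t | f t != 0].
  have -> : [set t | f t != 0] = f @^-1` (~` [set 0]).
    by apply/seteqP; split=> t /= /eqP.
  by apply: measurable_funPTI; apply: measurableC; exact: measurable_set1.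
apply/negligibleP => //; apply: negligibleS f0 => t /= ft0 /(_ I) ft.
by move/eqP: ft0; apply.
Qed.

(** * Indicators and a lower bound for an abstract version of the distance to [C] *)

Variable p : X -> R.
Hypothesis p_sublinear : sublinear p.
Hypothesis p_neg : forall x, nneg_cone x -> p (- x) <= 0.
Hypothesis p_pos : forall x, nneg_cone x -> p x <= 0 -> x = 0.

Lemma sublinear_nneg_le (x y : X) : nneg_cone (y - x) -> p x <= p y.
Proof.
move=> /p_neg; have := p_sublinear.1 y (x - y); rewrite addrC subrK opprB; lra.
Qed.

(** Membership of the indicator in [X] is part of the condition. As a function of [A], the value of
    [p] at the indicator is a monotone, subadditive set function. *)
Definition small_indic (A : set T) (c : R) := exists x : X, exists f : M,
  [/\ \val x = class_L0 mu f, forall t, f t = \1_A t & p x <= c].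

Lemma small_indicS (A B : set T) c : measurable B -> B `<=` A ->
  small_indic A c -> small_indic B c.
Proof.
move=> mB BA [x [f [xf fA xc]]].
have hf t : 0 <= mindic R mB t <= f t.
  rewrite fA /= !indicE ler0n/= ler_nat; case: (boolP (t \in B)) => //.
  by rewrite inE => /BA /mem_set ->.
have [y yh xy] := ideal_sub_class xf hf.
by exists y, (mindic R mB); split=> //; exact: le_trans (sublinear_nneg_le xy) xc.
Qed.

Lemma small_indicU (A B : set T) a b : measurable A -> measurable B ->
  small_indic A a -> small_indic B b -> small_indic (A `|` B) (a + b).
Proof.
move=> mA mB [x [f [xf fA xa]]] [y [h [yh hB yb]]].
have mAB := measurableU _ _ mA mB.
have xyE : \val (x + y) = class_L0 mu (f + h).
  by rewrite raddfD /= xf yh; exact: add_L0E.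
have kfh t : 0 <= mindic R mAB t <= (f + h) t.
  rewrite -[(f + h) t]/(f t + h t) fA hB -[mindic _ _ t]/(\1_(A `|` B) t : R).
  rewrite !indicE classical_sets.in_setU ler0n/= -natrD ler_nat.
  by case: (_ \in _); case: (_ \in _).
have [z zk zxy] := ideal_sub_class xyE kfh.
exists z, (mindic R mAB); split=> //.
apply: (le_trans (sublinear_nneg_le zxy)).
by apply: (le_trans (p_sublinear.1 _ _)); exact: lerD.
Qed.

(** The witnesses for different [c] all represent the same indicator, so monotonicity of [p] passes
    every bound to a single [x], which [p_pos] then forces to be 0. *)
Lemma small_indic_eq0 (A : set T) : measurable A ->
  (forall c, 0 < c -> small_indic A c) -> mu A = 0%E.
Proof.
move=> mA smallA.
have [x [f [xf fA _]]] := smallA 1 ltr01.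
have x0 : nneg_cone x.
  by rewrite /nneg_cone /= xf; apply/L0_ge0P/aeW => t; rewrite fA indicE.
have : x = 0.
  apply: p_pos => //; apply/ler_addgt0Pl => e e0; rewrite addr0.
  have [y [h [yh hA ye]]] := smallA e e0; apply: le_trans ye.
  by apply/sublinear_nneg_le/(nneg_coneB xf yh) => t; rewrite fA hA.
move=> x0'; have := class_L0_eq0 (f := f).
rewrite -xf x0' raddf0 /= => /(_ erefl).
congr (_ = _); congr (mu _); apply/seteqP; split=> t /=; rewrite fA indicE.
  by rewrite pnatr_eq0 eqb0 negbK inE.
by move=> At; rewrite mem_set// oner_neq0.
Qed.

(** This is the convex set K(A, e). The bounds hold everywhere for one representative, which keeps
    later comparisons pointwise. *)
Definition mass_above (A : set T) (e : R) : set X := [set x | exists u : M,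
  [/\ \val x = class_L0 mu u, forall t, 0 <= u t <= \1_A t &
    (e%:E <= \int[mu]_t (u t)%:E)%E]].

(* Otherwise sets [B n] of measure at least [e / 2] have [p \1_(B n) <= 2^-n]; the
   intersection of long finite unions of them is nonnull, yet its indicator is
   killed by [p]. *)
Lemma mass_above_bounded_below (A : set T) (e : R) :
  measurable A -> (mu A < +oo)%E -> 0 < e ->
  exists2 c, 0 < c & forall x, mass_above A e x -> c <= p x.
Proof.
move=> mA Afin e0.
apply/not_exists2P => noc.
have Afin' : mu A \is a fin_num by rewrite ge0_fin_numE.
pose m := fine (mu A).
have m0 : 0 <= m by exact: fine_ge0.
(* The level [eta] is low enough that the part of [u n] below it has integral at most
   [eta * m <= e / 2]; [m + 1] avoids dividing by 0 when [A] is null. *)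
pose eta := e / 2 / (m + 1).
have m1 : 0 < m + 1 by rewrite ltr_wpDl.
have eta0 : 0 < eta by rewrite !divr_gt0.
have etam : eta * m <= e / 2.
  rewrite /eta -mulrA ler_piMr ?divr_ge0 ?(ltW e0)//.
  by rewrite mulrC ler_pdivrMr// mul1r lerDl.
pose w n : R := (2 ^+ n)^-1.
have w0 n : 0 < w n by rewrite invr_gt0 exprn_gt0.
have wS n : w n = w n.+1 + w n.+1.
  by rewrite /w exprS invfM; field; rewrite expf_neq0.
have /choice[x xP] : forall n, exists x, mass_above A e x /\ p x < eta * w n.
  move=> n; have [/negP|] := noc (eta * w n).
    by rewrite mulr_gt0.
  by move=> /existsNP[x /not_implyP[Kx /negP]]; rewrite -ltNge => px; exists x.
have /choice[u uP] := fun n => (xP n).1.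
pose B n := [set t | eta <= u n t].
have mB n : measurable (B n).
  have -> : B n = u n @^-1` `[eta, +oo[.
    by apply/seteqP; split=> t /=; rewrite in_itv/= andbT.
  by apply: measurable_funPTI; exact: measurable_itv.
have BA n : B n `<=` A.
  move=> t /= eu; apply: contrapT => At.
  have [_ /(_ t) + _] := uP n; rewrite indicE memNset// => /andP[_].
  by rewrite leNgt (lt_le_trans eta0 eu).
(* The indicator of [B n] is at most [eta^-1 *: u n], and [p (x n) < eta * w n]. *)
have Bsmall n : small_indic (B n) (w n).
  have [xu uA _] := uP n.
  have sxE : \val (eta^-1 *: x n) = class_L0 mu (eta^-1 *: u n).
    by rewrite linearZ /= xu; exact: scale_L0E.
  have hu t : 0 <= mindic R (mB n) t <= (eta^-1 *: u n) t.
    rewrite -[mindic _ _ t]/(\1_(B n) t : R) indicE ler0n/=.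
    case: (boolP (t \in B n)) => [|_].
      by rewrite inE /B /= => eu; rewrite -ler_pdivrMl ?invr_gt0// invrK mulr1.
    by rewrite mulr_ge0 ?invr_ge0 ?(ltW eta0)//; have /andP[] := uA t.
  have [z zh zx] := ideal_sub_class sxE hu.
  exists z, (mindic R (mB n)); split=> //.
  apply: (le_trans (sublinear_nneg_le zx)).
  rewrite p_sublinear.2 ?invr_ge0 ?(ltW eta0)// ler_pdivrMl//.
  exact: ltW (xP n).2.
(* Integrate [u n <= \1_(B n) + eta * \1_A], which holds because [u n <= \1_A] everywhere and
   [u n < eta] off [B n]. *)
have muB n : ((e / 2)%:E <= mu (B n))%E.
  have [_ uA eu] := uP n.
  have mind E : measurable E -> measurable_fun setT (EFin \o (\1_E : T -> R)).
    by move=> mE; apply/measurable_EFinP; exact: measurable_indic.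
  have ind0 E t : (0 <= (\1_E t : R)%:E)%E by rewrite lee_fin indicE.
  have IE : (\int[mu]_t ((\1_(B n) t : R)%:E + eta%:E * (\1_A t : R)%:E) =
      mu (B n) + (eta * m)%:E)%E.
    rewrite ge0_integralD//; last 3 first.
    - exact: mind.
    - by move=> t _; rewrite mule_ge0// lee_fin ltW.
    - by apply: measurable_funeM; exact: mind.
    rewrite ge0_integralZl_EFin//; [|exact: mind|exact: ltW].
    by rewrite !integral_indic// !setIT [in RHS](EFinM eta) /m fineK.
  have uB : (\int[mu]_t (u n t)%:E <= mu (B n) + (eta * m)%:E)%E.
    rewrite -IE; apply: ge0_le_integral => //.
    - by move=> t _; rewrite lee_fin; have /andP[] := uA t.
    - by apply: measurableT_comp => //; exact: measurable_funP.
    - apply: emeasurable_funD; first exact: mind.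
      by apply: measurable_funeM; exact: mind.
    - move=> t _; rewrite -EFinM -EFinD lee_fin.
      have /andP[_ utA] := uA t.
      case: (lerP eta (u n t)) => [eut|ute].
        rewrite [\1_(B n) t]indicE mem_set// (le_trans utA)// indicE.
        by case: (_ \in _); rewrite /= ?mulr1 ?mulr0 ?addr0// lerDl ltW.
      rewrite [\1_(B n) t]indicE memNset; last by apply/negP; rewrite -ltNge.
      rewrite add0r; move: utA; rewrite indicE; case: (_ \in _) => /=.
        by rewrite mulr1 => _; exact: ltW.
      by rewrite mulr0.
  have := le_trans eu uB; rewrite -leeBlDr//; apply: le_trans.
  rewrite -EFinB lee_fin; lra.
have e2 : 0 < e / 2 by rewrite divr_gt0.
have [j jP] := measure_limsup_core mA Afin mB BA e2 muB.
move/eqP: jP; apply.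
pose U n k := \big[setU/set0]_(i < k.+1) B (n + i)%N.
have mU n k : measurable (U n k) by apply: bigsetU_measurable => i _; exact: mB.
(* The bound is the geometric sum of [w n], ..., [w (n + k)], in the closed form given by
   [w n = 2 * w n.+1]. *)
have Usmall n k : small_indic (U n k) (w n + w n - w (n + k)%N).
  elim: k => [|k IH]; first by rewrite /U big_ord1 addn0 addrK.
  rewrite /U big_ord_recr/= -/(U n k).
  have -> : w n + w n - w (n + k.+1)%N = w n + w n - w (n + k)%N + w (n + k.+1)%N.
    by rewrite [w (n + k)%N]wS addnS; ring.
  exact: small_indicU (mU n k) (mB _) IH (Bsmall _).
have mE : measurable (\bigcap_n U n (j n)).
  by apply: bigcap_measurable => // n _; exact: mU.
apply: (small_indic_eq0 mE).
move=> c c0.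
have [n nc] : exists n, w n + w n <= c.
  have c2 : (0 < (c / 2)%:E)%E by rewrite lte_fin divr_gt0.
  have [n nc] := lt_natSinv c2.
  exists n; have : w n <= n.+1%:R^-1.
    rewrite lef_pV2 ?posrE ?ltr0n ?exprn_gt0// -natrX ler_nat.
    by rewrite ltn_expl.
  by move=> /le_lt_trans /(_ nc) wc; rewrite [leRHS]splitr lerD// ltW.
(* Being inside every [U n (j n)], the intersection inherits the bound [2 * w n] for each [n], hence
   any [c > 0]. *)
have EU : \bigcap_k U k (j k) `<=` U n (j n) by move=> t; apply.
have [z [h [zh hE hz]]] := small_indicS mE EU (Usmall n (j n)).
exists z, h; split=> //; apply: (le_trans hz).
by rewrite (le_trans _ nc)// lerBlDr lerDl ltW.
Qed.

(** * Positive functionals, first on a set of finite measure and then on [X] *)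

Let mpos (f : M) : measurable [set t | 0 < f t].
Proof.
have -> : [set t | 0 < f t] = f @^-1` `]0, +oo[.
  by apply/seteqP; split=> t /=; rewrite in_itv/= andbT.
by apply: measurable_funPTI; exact: measurable_itv.
Qed.

Lemma mass_above_convex (A : set T) (e : R) (s t : R) (x y : X) :
  0 <= s -> 0 <= t -> s + t = 1 -> mass_above A e x -> mass_above A e y ->
  mass_above A e (s *: x + t *: y).
Proof.
move=> s0 t0 st [u [xu uA eu]] [v [yv vA ev]].
exists (s *: u + t *: v); split.
- rewrite raddfD /= !linearZ /= xu yv.
  have -> : s *: class_L0 mu u = class_L0 mu (s *: u) by exact: scale_L0E.
  have -> : t *: class_L0 mu v = class_L0 mu (t *: v) by exact: scale_L0E.
  exact: add_L0E.
- move=> r; have /andP[u0 u1] := uA r; have /andP[v0 v1] := vA r.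
  rewrite -[_ r]/(s * u r + t * v r) addr_ge0 ?mulr_ge0//=.
  by rewrite -[leRHS]mul1r -st mulrDl lerD// ler_wpM2l.
- have u0 r : (0 <= (u r)%:E)%E by rewrite lee_fin; have /andP[] := uA r.
  have v0 r : (0 <= (v r)%:E)%E by rewrite lee_fin; have /andP[] := vA r.
  have mf (f : M) : measurable_fun setT (EFin \o f).
    by apply: measurableT_comp => //; exact: measurable_funP.
  have mfZ a (f : M) : measurable_fun setT (fun r => a%:E * (f r)%:E)%E.
    by apply: measurable_funeM; exact: mf.
  have -> : (\int[mu]_r ((s *: u + t *: v) r)%:E =
      \int[mu]_r (s%:E * (u r)%:E + t%:E * (v r)%:E))%E.
    by apply: eq_integral => r _; rewrite -!EFinM -EFinD.
  rewrite ge0_integralD//; [|by move=> r _; rewrite mule_ge0|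
    by move=> r _; rewrite mule_ge0].
  rewrite !ge0_integralZl_EFin//; try exact: mf.
  rewrite -[e]mul1r -st mulrDl EFinD !EFinM.
  by apply: leeD; apply: lee_wpmul2l => //; rewrite lee_fin.
Qed.

(** For each [n] a functional below [p] is positive on K(A, 1/(n+1)), and these are summed. A
    nonnegative [x] that is nonzero on [A] dominates an element of one of these sets. *)
Lemma local_positive_functional (A : set T) : measurable A -> (mu A < +oo)%E ->
  exists g : {linear X -> R^o}, (forall x, g x <= p x) /\
    forall (x : X) (f : M), \val x = class_L0 mu f -> (forall t, 0 <= f t) ->
      mu ([set t | 0 < f t] `&` A) != 0%E -> 0 < g x.
Proof.
move=> mA Afin.
have /choice[g gP] : forall n, exists g : {linear X -> R^o},
    (forall x, g x <= p x) /\
    (forall x, mass_above A n.+1%:R^-1 x -> 0 < g x).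
  move=> n; have n0 : 0 < n.+1%:R^-1 :> R by rewrite invr_gt0.
  have [c c0 cp] := mass_above_bounded_below mA Afin n0.
  have [K0|K0] := pselect (mass_above A n.+1%:R^-1 !=set0); last first.
    have [g gp] := hahn_banach p_sublinear; exists g; split=> // x Kx.
    by case: K0; exists x.
  have [g [gp gc]] := hahn_banach_convex p_sublinear K0
    (@mass_above_convex A _) cp.
  by exists g; split=> // x /gc; exact: lt_le_trans.
have [h [hp h0]] := sublinear_countable_sum p_sublinear (fun n => (gP n).1).
exists h; split=> // x f xf f0 fA.
(* The truncation lies below both [f] and the indicator of [A], and it is positive exactly where [f]
   is positive on [A], so its integral is positive and exceeds some [n.+1%:R^-1]. *)
pose u : M := f \min mindic R mA.
have u0 t : 0 <= u t.
  by rewrite le_min f0 -[X in _ <= X]/(\1_A t : R) indicE ler0n.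
have uf t : 0 <= u t <= f t by rewrite u0 ge_min lexx.
have u1 t : 0 <= u t <= \1_A t by rewrite u0 ge_min lexx orbT.
have [y yu xy] := ideal_sub_class xf uf.
have hxy : h y <= h x.
  rewrite -subr_ge0 -linearB -oppr_le0 -linearN.
  exact: le_trans (hp _) (p_neg xy).
have mu_ : measurable_fun setT (EFin \o u).
  by apply: measurableT_comp => //; exact: measurable_funP.
have Iu : (0 < \int[mu]_t (u t)%:E)%E.
  rewrite lt0e integral_ge0 ?andbT; last first.
    by move=> t _; rewrite lee_fin; have /andP[] := uf t.
  apply: contra_neq fA => Iu0.
  have u_ae : ae_eq mu setT (EFin \o u) (cst 0%E).
    apply/ae_eq_integral_abs => //; rewrite -Iu0; apply: eq_integral => t _.
    by rewrite gee0_abs// lee_fin; have /andP[] := uf t.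
  apply/negligibleP; first exact: measurableI (mpos f) mA.
  apply: negligibleS u_ae => t /= [ft At] /(_ I) [].
  apply/eqP; rewrite gt_eqF// lt_min ft -[X in _ < X]/(\1_A t : R) indicE.
  by rewrite mem_set// ltr01.
have [n nu] := lt_natSinv Iu.
apply: (lt_le_trans _ hxy); apply: h0.
  by apply: p_neg; rewrite /nneg_cone /= yu; exact/L0_ge0P/aeW.
by exists n; apply: (gP n).2; exists u; split=> //; exact: ltW.
Qed.

Lemma strictly_positive_functional : sigma_finite setT mu ->
  exists g : {linear X -> R^o},
    (forall x, g x <= p x) /\ strictly_positive g.
Proof.
move=> sf.
(* Exhaustion is applied to the supports of nonnegative elements of [X]; a union of two supports is
   the support of the sum. *)
pose P := [set A : set T | exists x : X, exists f : M,
  [/\ \val x = class_L0 mu f, forall t, 0 <= f t & A = [set t | 0 < f t]]].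
have P0 : P set0.
  exists 0, 0; split=> //; first by rewrite raddf0.
  by apply/seteqP; split=> t //=; rewrite ltxx.
have mP A : P A -> measurable A by move=> [x [f [_ _ ->]]].
have PU A B : P A -> P B -> P (A `|` B).
  move=> [x [f [xf f0 ->]]] [y [h [yh h0 ->]]].
  exists (x + y), (f + h); split.
  - by rewrite raddfD /= xf yh; exact: add_L0E.
  - by move=> t; rewrite -[_ t]/(f t + h t) addr_ge0.
  - apply/seteqP; split=> t; rewrite /=.
      by case=> ?; [exact: ltr_wpDr|exact: ltr_wpDl].
    have [|] := ltP 0 (f t); first by left.
    by move=> ft fht; right; apply: (lt_le_trans fht); rewrite gerDr.
have [A [mA Afin AP]] := sigma_finite_exhaustion sf P0 mP PU.
have /choice[g gP] := fun n => local_positive_functional (mA n) (Afin n).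
have [h [hp h0]] := sublinear_countable_sum p_sublinear (fun n => (gP n).1).
exists h; split=> // x x0 xn0; apply: h0; first exact: p_neg.
have [f xf f0] := nneg_cone_class x0.
(* A null support would give [x = 0], so some [A n] meets the support in a nonnull set. *)
have [||n nA] := AP [set t | 0 < f t]; first by exists x, f.
  apply: contra_neq xn0 => muf; apply: val_inj; rewrite raddf0 xf.
  apply/(class_L0P mu f 0); move: muf.
  move=> /(negligibleP mu (mpos f)); apply: negligibleS.
  by move=> t /= /not_implyP[_ /eqP ft]; rewrite lt_neqAle f0 eq_sym ft.
by exists n; exact: (gP n).2 xf f0 nA.
Qed.

End BanachIdealFunctional.

(** * The theorem, with [p] the distance to [C] *)

Lemma convex_coneD (R : realType) (V : normedModType R) (C : set V) (x y : V) :
  convex_set C -> (forall (t : R) z, 0 <= t -> C z -> C (t *: z)) ->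
  C x -> C y -> C (x + y).
Proof.
move=> convC CZ Cx Cy.
(* The sum is twice the midpoint. *)
have h0 : 0 <= 2^-1 :> R by rewrite invr_ge0.
have h1 : 2^-1 <= 1 :> R by lra.
have := convC x y (Itv01 h0 h1); rewrite !inE => /(_ Cx Cy).
move=> /(CZ 2 _ (ler0n _ 2)).
have -> : conv (Itv01 h0 h1) (x : convex_lmodType V) y = 2^-1 *: (x + y) :> V.
  by rewrite scalerDr; congr (_ + _ *: _); rewrite -[LHS]/(1 - 2^-1 : R); field.
by rewrite scalerA mulfV ?pnatr_eq0// scale1r.
Qed.

Theorem theorem1 (d : measure_display) (T : measurableType d) (R : realType)
    (mu : {measure set T -> \bar R})
    (mu_complete : measure_is_complete mu)
    (mu_sigma_finite : sigma_finite [set: T] mu)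
    (S : pred (L0 mu)) (X : banachIdealType S) :
  Kreps_Yan_property X.
Proof.
move=> C clC [convC CZ] CX negC.
have C0 : C 0 by have [] : (C `&` nneg_cone (X:=X)) 0 by rewrite CX.
have CD x y : C x -> C y -> C (x + y) by exact: convex_coneD convC CZ.
have p_neg (x : X) : nneg_cone x -> cone_dist C (- x) <= 0.
  by move=> x0; apply: cone_dist_le0 => //; apply: negC; exists x.
have p_pos (x : X) : nneg_cone x -> cone_dist C x <= 0 -> x = 0.
  move=> x0 /(cone_dist_closed C0 clC) Cx.
  by have : (C `&` nneg_cone (X:=X)) x by []; rewrite CX.
have [g [gp gpos]] := strictly_positive_functional
  (cone_dist_sublinear C0 CD CZ) p_neg p_pos mu_sigma_finite.
exists g; split=> //; last first.
  by move=> x Cx; apply: le_trans (gp x) _; exact: cone_dist_le0.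
(* The distance to [C] is at most the norm, so [g] is too, at both [x] and [- x]; hence every
   [r >= 1] is a bound for [g]. *)
apply: bounded_linear_continuous; apply/linear_boundedP.
near=> r => x; have r1 : 1 <= r by near: r; exact: nbhs_pinfty_ge.
apply: (@le_trans _ _ `|x|); last by rewrite ler_peMl.
have gx z : g z <= `|z| := le_trans (gp z) (cone_dist_le_norm C0 z).
by rewrite ler_norml gx lerNl -linearN -normrN gx.
Unshelve. all: by end_near. Qed.
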